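(* For every fixed real $\gamma>\gamma_{\rm sgn}$, one has $\Gamma_{2^n}(B_1^n)\leq\gamma$ for all sufficiently large $n$. Consequently, $$\limsup_{n\to\infty}\Gamma_{2^n}(B_1^n)\leq\gamma_{\rm sgn}.$$
   Context: For a convex body $K\subset\mathbb{R}^n$ (compact convex set with nonempty interior) and an integer $m\geq1$, $$\Gamma_m(K)=\inf\Big\{\gamma>0:\ \exists\, c_1,\ldots,c_m\in\mathbb{R}^n\ \text{such that}\ K\subseteq\bigcup_{i=1}^m(c_i+\gamma K)\Big\}.$$ $B_1^n=\{x\in\mathbb{R}^n:\ \|x\|_1\leq1\}$, where $\|x\|_1=\sum_{i=1}^n|x_i|$. The number $\gamma_{\rm sgn}\in(1/2,1)$ is the unique solution in $(1/2,1)$ of the equation $-\ln\gamma+(1-\gamma)\ln2=\ln2$ (numerically $\gamma_{\rm sgn}=0.641\cdots$). The dimension $n$ is an integer with $n\geq2$. *)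

(* Defs.v *)
From HB Require Import structures.
From mathcomp Require Import all_boot all_order all_algebra.
From mathcomp Require Import all_classical all_reals all_analysis.
From mathcomp Require Import lra.

Set Implicit Arguments.
Unset Strict Implicit.
Unset Printing Implicit Defensive.

Import Order.TTheory GRing.Theory Num.Theory.
Import numFieldNormedType.Exports.

Local Open Scope classical_set_scope.
Local Open Scope ring_scope.

(* [c + g K] *)
Definition homothet (R : realType) (n : nat) (c : 'rV[R]_n) (g : R)
    (K : set 'rV[R]_n) : set 'rV[R]_n :=
  [set c + g *: x | x in K].

(* The infimum is taken in the extended reals, so that it would be +oo (and
   not a default real value) if no [g] were admissible. For m >= 1 it is
   finite: g = 1 is admissible and 0 is a lower bound. *)
Definition Gamma (R : realType) (n m : nat) (K : set 'rV[R]_n) : \bar R :=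
  ereal_inf [set g%:E | g in [set g : R | 0 < g /\
    exists c : 'I_m -> 'rV[R]_n, K `<=` \bigcup_(i : 'I_m) homothet (c i) g K]].

(* [`|x|] is the sup norm on ['rV[R]_n], hence the explicit sum. *)
Definition norm1 (R : realType) (n : nat) (x : 'rV[R]_n) : R :=
  \sum_(i < n) `|x ord0 i|.

Definition cross_polytope (R : realType) (n : nat) : set 'rV[R]_n :=
  [set x | norm1 x <= 1].

Definition gamma_sgn_spec (R : realType) (g : R) : Prop :=
  2^-1 < g < 1 /\ - ln g + (1 - g) * ln 2 = ln 2.

(* The default value 0 is never used, by [gamma_sgn_exists_unique]. *)
Definition gamma_sgn (R : realType) : R := xget 0 [set g : R | gamma_sgn_spec g].

Lemma gamma_sgn_exists_unique (R : realType) :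
  exists! g : R, gamma_sgn_spec g.
Proof.
have l2 : 0 < ln 2 :> R by rewrite ln_gt0 // ltr1n.
pose f (g : R) := - ln g + (1 - g) * ln 2.
have fdec (x y : R) : 0 < x -> x < y -> f y < f x.
  move=> x0 xy; have y0 : 0 < y := lt_trans x0 xy.
  have : ln x < ln y by rewrite ltr_ln.
  rewrite /f; nra.
have fcont : {within `[2^-1, 1], continuous f}.
  apply: continuous_in_subspaceT => x; rewrite inE/= in_itv/= => /andP[hx _].
  have x0 : 0 < x by apply: lt_le_trans hx; rewrite invr_gt0.
  apply: cvgD; first by apply: cvgN; exact: continuous_ln.
  by apply: cvgM; [apply: cvgB; [exact: cvg_cst|exact: cvg_id]|exact: cvg_cst].
have half1 : (2^-1 : R) <= 1 by lra.
have fh : f 2^-1 = ln 2 + (1 - 2^-1) * ln 2.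
  by rewrite /f lnV ?opprK// posrE.
have f1 : f 1 = 0 by rewrite /f ln1 oppr0 subrr mul0r addr0.
have [|g] := @IVT R f _ _ (ln 2) half1 fcont.
  by rewrite fh f1 ge_min le_max; apply/andP; split; apply/orP; [right|left]; nra.
rewrite in_itv/= => /andP[hg g1] fg.
exists g; split.
  split => //; apply/andP; split.
    by rewrite lt_neqAle hg andbT; apply/eqP => e; move: fg; rewrite -e fh; nra.
  by rewrite lt_neqAle g1 andbT; apply/eqP => e; move: fg; rewrite e f1; nra.
move=> y [/andP[hy y1] fy].
have g0 : 0 < g by apply: lt_le_trans hg; rewrite invr_gt0.
have y0 : 0 < y by apply: lt_trans hy; rewrite invr_gt0.
have fgy : f y = f g by rewrite fg.
case: (ltgtP g y) => // [gy|yg].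
- by have := fdec _ _ g0 gy; rewrite fgy ltxx.
- by have := fdec _ _ y0 yg; rewrite fgy ltxx.
Qed.

Lemma gamma_sgnP (R : realType) : gamma_sgn_spec (gamma_sgn R).
Proof.
have [g [hg _]] := gamma_sgn_exists_unique R.
exact: (@xgetPex _ 0 [set g : R | gamma_sgn_spec g] (ex_intro _ g hg)).
Qed.

(* Main.v *)
(* Write [a = 1 - b] with [gamma_sgn < b < g], and scale [x] so that its l1 norm
   is at most [n]. Let [x_(1) >= x_(2) >= ...] be the decreasing rearrangement of
   the [|x_i|]. The profile [x_(floor (j / a) + 1)], [0 <= j < a n], has about
   [a n] terms and total mass at least [a] times the mass of [x]. If it is placed
   injectively on coordinates where it is dominated by [|x_i|], with the signs of
   [x], then subtracting it from [x] leaves l1 norm at most [b n]. Filling the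
   slots in order leaves at least [j b / a] choices for the [j]-th one, so a
   uniformly random injection works with probability about
   [(b / a) ^ m m! (n - m)! / n! >= b ^ n] (up to polynomial factors, [m] being
   about [a n]), and uniform signs work with probability [2 ^ - m]. After rounding
   [x] to the grid of the [(h u) ^ 2], the profile is determined by
   [O (sqrt n)] integers in [[0, n]], so that guessing it at random costs only a
   subexponential factor. Hence [2 ^ n] random centers suffice as soon as
   [b 2 ^ b > 1], that is [b > gamma_sgn]. *)

Require Import Defs.
From HB Require Import structures.
From mathcomp Require Import all_boot all_order all_algebra.
From mathcomp Require Import all_classical all_reals all_analysis.
From mathcomp Require Import lra ring.

Set Implicit Arguments.
Unset Strict Implicit.
Unset Printing Implicit Defensive.

Import Order.TTheory GRing.Theory Num.Theory.
Import numFieldNormedType.Exports.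
Local Open Scope ring_scope.

(** * Covering by random centers *)

(* Union bound over [X]: [N] independent uniform centers in [D] all miss [x] with
   probability at most [expR (- p * N)]. *)
Lemma random_cover (R : realType) (X C : finType) (D : {set C})
    (good : X -> {set C}) (p : R) (N : nat) :
  (0 < #|D|)%N -> (forall x, good x \subset D) ->
  (forall x, p * #|D|%:R <= #|good x|%:R) ->
  #|X|%:R < expR (p * N%:R) ->
  exists c : 'I_N -> C, forall x, exists i, c i \in good x.
Proof.
move=> D0 gD gp Xlt.
pose missing x := D :\: good x.
have missE x : #|missing x|%:R <= expR (- p) * #|D|%:R :> R.
  rewrite cardsD (finset.setIidPr (gD x)) natrB ?subset_leq_card//.
  have : (1 - p) * #|D|%:R <= expR (- p) * #|D|%:R.
    by apply: ler_wpM2r => //; exact: expR_ge1Dx.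
  by have := gp x; lra.
pose F := [set f : {ffun 'I_N -> C} | f \in ffun_on D].
pose B x := [set f : {ffun 'I_N -> C} | f \in ffun_on (missing x)].
have cardF : #|F| = (#|D| ^ N)%N by rewrite cardsE card_ffun_on card_ord.
have cardB x : #|B x| = (#|missing x| ^ N)%N.
  by rewrite cardsE card_ffun_on card_ord.
have : (#|\bigcup_x B x| < #|F|)%N.
  have h : #|\bigcup_x B x|%:R <= \sum_x (#|B x|%:R : R).
    rewrite -natr_sum ler_nat.
    elim/big_ind2 : _ => [|S1 n1 S2 n2 h1 h2|//]; first by rewrite cards0.
    by rewrite (leq_trans (leq_card_setU _ _))// leq_add.
  rewrite -(ltr_nat R) (le_lt_trans h)//.
  apply: (@le_lt_trans _ _ (\sum_(x : X) (expR (- p) * #|D|%:R) ^+ N)).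
    by apply: ler_sum => x _; rewrite cardB natrX lerXn2r ?nnegrE// mulr_ge0 ?expR_ge0.
  rewrite sumr_const -[ltLHS]mulr_natl exprMn mulrA cardF natrX.
  rewrite -[ltRHS]mul1r ltr_pM2r ?exprn_gt0 ?ltr0n//.
  rewrite -expRM_natl mulrN expRN ltr_pdivrMr ?expR_gt0// mul1r.
  by rewrite mulrC.
move=> ltBF; have [f] : exists2 f, f \in F & f \notin \bigcup_x B x.
  by apply/subsetPn; apply: contraL ltBF => /subset_leq_card; rewrite -leqNgt.
rewrite inE => /ffun_onP fD /bigcupP fB.
exists f => x; apply/existsP; apply: contra_notT fB => /existsPn fx.
by exists x => //; rewrite inE; apply/ffun_onP => i; rewrite inE fx fD.
Qed.

(** * Counting injections with prescribed value sets *)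

Lemma leq_card_setD_codom (T : finType) (m : nat) (A : {set T}) (f : {ffun 'I_m -> T}) :
  (#|A| - m <= #|A :\: f @: 'I_m|)%N.
Proof.
rewrite cardsD leq_sub2l// (leq_trans (subset_leq_card (finset.subsetIr _ _)))//.
by rewrite (leq_trans (leq_imset_card _ _))// card_ord.
Qed.

(** Choose the values in order: at step [j] at most [j] elements of [A j] are already taken. If some
    [A j] has at most [j] elements, the truncated difference makes the product 0. *)
Lemma prod_le_card_inj (T : finType) (m : nat) (A : nat -> {set T}) :
  (\prod_(j < m) (#|A j| - j) <=
     #|[set f : {ffun 'I_m -> T} | injectiveb f & [forall j, f j \in A j]]|)%N.
Proof.
elim: m => [|m IHm].
  rewrite big_ord0 card_gt0; apply/set0Pn.
  exists (finfun (fun j : 'I_0 => match j with Ordinal j lt_j0 =>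
     False_rect T (notF lt_j0) end)).
  by rewrite inE; apply/andP; split; [apply/injectiveP => -[]|apply/forallP => -[]].
set S := [set f : {ffun 'I_m -> T} | _ & _] in IHm.
(* An injection on [m.+1] slots is coded by its restriction to the first [m] and its last value. *)
pose extend (p : {ffun 'I_m -> T} * T) : {ffun 'I_m.+1 -> T} :=
  [ffun i => if unlift ord_max i is Some j then p.1 j else p.2].
have extend_lift p j : extend p (lift ord_max j) = p.1 j.
  by rewrite ffunE liftK.
have extend_max p : extend p ord_max = p.2 by rewrite ffunE unlift_none.
have extend_inj : injective extend.
  move=> p q epq; rewrite [p]surjective_pairing [q]surjective_pairing; congr pair.
    by apply/ffunP => j; rewrite -!extend_lift epq.
  by rewrite -!extend_max epq.
pose P := [set p : {ffun 'I_m -> T} * T | p.1 \in S & p.2 \in A m :\: p.1 @: 'I_m].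
rewrite big_ord_recr/=; apply: (@leq_trans #|P|).
  have -> : #|P| = (\sum_(f in S) #|A m :\: f @: 'I_m|)%N.
    rewrite -sum1_card.
    under eq_bigl do rewrite inE.
    rewrite -(pair_big_dep (mem S) (fun f a => a \in A m :\: f @: 'I_m) (fun _ _ => 1%N))/=.
    by apply: eq_bigr => f _; rewrite sum1_card.
  rewrite (leq_trans (leq_mul IHm (leqnn _)))//.
  by rewrite -sum_nat_const leq_sum// => f _; exact: leq_card_setD_codom.
rewrite -(card_imset _ extend_inj); apply/subset_leq_card/fintype.subsetP => _ /imsetP[p pP ->].
rewrite inE in pP; have /andP[p1S /finset.setDP[p2A p2N]] := pP.
rewrite inE in p1S; have /andP[/injectiveP p1I /forallP p1A] := p1S.
rewrite inE; apply/andP; split.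
  have p2j j : p.1 j != p.2.
    by apply: contraNneq p2N => <-; exact: imset_f.
  apply/injectiveP => i j; case: (unliftP ord_max i) => [i' ->|->];
    case: (unliftP ord_max j) => [j' ->|->]; rewrite ?(extend_lift, extend_max)//.
  - by move=> /p1I ->.
  - by move=> /eqP; rewrite (negPf (p2j _)).
  - by move=> /esym/eqP; rewrite (negPf (p2j _)).
apply/forallP => i; case: (unliftP ord_max i) => [i' ->|->].
  by rewrite extend_lift; have := p1A i'; rewrite lift_max.
by rewrite extend_max.
Qed.

(** * Tail counts and quantiles of level functions *)

(** The bounded codomain leaves only [n.+1 ^ K] possible profiles to guess from; by [tailE], [inord]
    never falls back on its default. *)
Definition tail (n K : nat) (l : {ffun 'I_n -> 'I_K}) : {ffun 'I_K -> 'I_n.+1} :=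
  [ffun v : 'I_K => inord #|[set i | (v < l i)%N]|].

Lemma tailE (n K : nat) (l : {ffun 'I_n -> 'I_K}) (v : 'I_K) :
  tail l v = #|[set i | (v < l i)%N]| :> nat.
Proof. by rewrite ffunE inordK// ltnS -[leqRHS](card_ord n) max_card. Qed.

(* On [t = tail l] this is the value of rank about [j / a] in the decreasing
   rearrangement of [l]; the empty maximum [0] is the lowest level, as wanted. *)
Definition quantile (R : realType) (a : R) (n K : nat)
    (t : {ffun 'I_K -> 'I_n.+1}) (j : nat) : nat :=
  \max_(v : 'I_K | j%:R < a * (t v)%:R) v.+1.

Lemma quantile_attained (R : realType) (a : R) (n K : nat)
    (t : {ffun 'I_K -> 'I_n.+1}) (j : nat) :
  quantile a t j = 0%N \/
  exists2 v, j%:R < a * (t v)%:R & quantile a t j = v.+1.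
Proof.
rewrite /quantile; elim/big_ind : _ => [|x y hx hy|v jv]; first by left.
  by rewrite maxnE -maxnE; case: (leqP x y) => xy; [exact: hy|exact: hx].
by right; exists v.
Qed.

Lemma quantile_le (R : realType) (a : R) (n K : nat)
    (t : {ffun 'I_K -> 'I_n.+1}) (j : nat) : (quantile a t j <= K)%N.
Proof. by case: (quantile_attained a t j) => [->|[v _ ->]]. Qed.

Lemma quantile_card (R : realType) (a : R) (n K : nat)
    (l : {ffun 'I_n -> 'I_K}) (j : nat) :
  j%:R <= a * n%:R ->
  j%:R <= a * #|[set i | (quantile a (tail l) j <= l i)%N]|%:R.
Proof.
case: (quantile_attained a (tail l) j) => [-> jn|[v jv -> _]].
  by rewrite (eq_card (B := 'I_n)) ?card_ord// => i; rewrite !inE.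
by rewrite tailE in jv; exact: ltW.
Qed.

(** This serves slot 0, where the bound of [quantile_card] is void. *)
Lemma quantile_card_gt0 (R : realType) (a : R) (n K : nat)
    (l : {ffun 'I_n -> 'I_K}) (j : nat) :
  (0 < n)%N -> (0 < #|[set i | (quantile a (tail l) j <= l i)%N]|)%N.
Proof.
move=> n0; case: (quantile_attained a (tail l) j) => [->|[v jv ->]].
  by rewrite (eq_card (B := 'I_n)) ?card_ord// => i; rewrite !inE.
rewrite tailE in jv; rewrite lt0n; apply: contraTneq jv => ->.
by rewrite mulr0 -leNgt.
Qed.

Lemma le_sum_lt_nat (R : realType) (y : R) (m : nat) :
  y <= m%:R -> y <= \sum_(j < m) (j%:R < y)%R%:R.
Proof.
elim: m => [|m IHm] ym; first by rewrite big_ord0.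
rewrite big_ord_recr/=; have [ym'|my] := leP y m%:R.
  by rewrite addr0 IHm.
rewrite (eq_bigr (fun=> 1)); last first.
  by move=> j _; rewrite (le_lt_trans _ my)// ler_nat ltnW.
by rewrite sumr_const card_ord -mulrSr.
Qed.

(** The increments of [f] below [u] telescope. *)
Lemma layer_cake (R : realType) (f : nat -> R) (K u : nat) :
  f 0%N = 0 -> (u <= K)%N ->
  f u = \sum_(v < K) (v < u)%N%:R * (f v.+1 - f v).
Proof.
move=> f0 uK; under eq_bigr do rewrite mulr_natl mulrb.
rewrite -big_mkcond/= (big_ord_narrow uK)/=.
rewrite -(big_mkord xpredT (fun v => f v.+1 - f v)) telescope_sumr//.
by rewrite f0 subr0.
Qed.

(* By [layer_cake] it is enough to compare the number of [j] below [a * y]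
   with [a * y], where [y] is the number of coordinates above a given level. *)
Lemma quantile_sum (R : realType) (a : R) (n K m : nat)
    (l : {ffun 'I_n -> 'I_K}) (f : nat -> R) :
  {homo f : u v / (u <= v)%N >-> u <= v} -> f 0%N = 0 ->
  0 <= a -> a * n%:R <= m%:R ->
  a * \sum_i f (l i) <= \sum_(j < m) f (quantile a (tail l) j).
Proof.
move=> f_nd f0 a0 anm.
have df v : 0 <= f v.+1 - f v by rewrite subr_ge0 f_nd.
under eq_bigr do rewrite (layer_cake f0 (ltnW (ltn_ord _))).
under [leRHS]eq_bigr do rewrite (layer_cake f0 (quantile_le _ _ _)).
rewrite exchange_big [leRHS]exchange_big/= mulr_sumr ler_sum// => v _.
rewrite -!mulr_suml mulrA ler_wpM2r//.
have -> : \sum_(i < n) (v < l i)%N%:R = (tail l v)%:R :> R.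
  rewrite -natr_sum tailE -sum1_card [in RHS]big_mkcond/=; congr _%:R.
  by apply: eq_bigr => i _; rewrite inE; case: ltnP.
apply: (@le_trans _ _ (\sum_(j < m) (j%:R < a * (tail l v)%:R)%R%:R)).
  apply: le_sum_lt_nat; apply: le_trans anm; rewrite ler_wpM2l// ler_nat.
  by rewrite -ltnS.
apply: ler_sum => j _; rewrite ler_nat; case: ltP => // jv.
by rewrite lt0b; apply: (leq_bigmax_cond (F := fun v : 'I_K => v.+1)); exact: jv.
Qed.

(** * Success probability of a random injection *)

(** The left side is a single term of the expansion of [(a + b) ^+ n = 1]. *)
Lemma bin_le_inv (R : realType) (a b : R) (n m : nat) :
  0 <= a -> 0 <= b -> a + b = 1 -> (m <= n)%N ->
  'C(n, m)%:R * a ^+ m * b ^+ (n - m) <= 1.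
Proof.
move=> a0 b0 ab1 mn.
apply: (@le_trans _ _ ((b + a) ^+ n)); last by rewrite addrC ab1 expr1n.
rewrite exprDn (bigD1 (Ordinal (mn : m < n.+1)%N))//=.
rewrite -mulrA mulr_natl [b ^+ _ * _]mulrC lerDl sumr_ge0// => i _.
by rewrite mulrn_wge0// mulr_ge0// exprn_ge0.
Qed.

(** Slot 0 contributes a factor at least 1, and slot [j >= 1] at least
    [j / a - j = j (1 - a) / a]. *)
Lemma prod_card_quantile (R : realType) (a : R) (n K q : nat)
    (l : {ffun 'I_n -> 'I_K}) :
  0 < a < 1 -> (0 < n)%N -> q%:R <= a * n%:R ->
  ((1 - a) / a) ^+ q * q`!%:R <=
  (\prod_(j < q.+1) (#|[set i | (quantile a (tail l) j <= l i)%N]| - j))%:R.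
Proof.
move=> /andP[a0 a1] n0 qn; rewrite big_ord_recl/= subn0.
rewrite fact_prod big_add1/= big_mkord !natr_prod natrM.
rewrite -[leLHS]mul1r ler_pM ?ler1n ?quantile_card_gt0//.
  by rewrite mulr_ge0 ?prodr_ge0// exprn_ge0// divr_ge0 ?ltW// subr_gt0.
rewrite -[in _ ^+ q](card_ord q) -prodr_const -big_split/= natr_prod ler_prod// => j _.
rewrite mulr_ge0 ?divr_ge0 ?(ltW a0) ?subr_ge0 ?(ltW a1)//=.
set A := [set i | _]; have jA : (bump 0 j)%:R <= a * #|A|%:R.
  by apply: quantile_card; apply: le_trans qn; rewrite ler_nat.
apply: (@le_trans _ _ (#|A|%:R - (bump 0 j)%:R)); last first.
  have [jA'|/ltnW Aj] := leqP (bump 0 j) #|A|; first by rewrite natrB.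
  by rewrite (le_trans (y := 0))// subr_le0 ler_nat.
rewrite mulrAC ler_pdivrMr// mulrBl mulrBl mul1r lerB//.
  by rewrite mulrC.
by rewrite mulrC.
Qed.

Lemma prod_card_quantile_ffact (R : realType) (a : R) (n K q : nat)
    (l : {ffun 'I_n -> 'I_K}) :
  0 < a < 1 -> (q < n)%N -> q%:R <= a * n%:R ->
  a * (1 - a) ^+ n / ((1 - a) * q.+1%:R) * (n ^_ q.+1)%:R <=
  (\prod_(j < q.+1) (#|[set i | (quantile a (tail l) j <= l i)%N]| - j))%:R.
Proof.
move=> a01 qn qan; have /andP[a0 a1] := a01.
have b0 : 0 < 1 - a by rewrite subr_gt0.
apply: le_trans (prod_card_quantile l a01 (leq_ltn_trans (leq0n q) qn) qan).
have := @bin_le_inv R a (1 - a) n q.+1 (ltW a0) (ltW b0) (subrKC _ _) qn.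
have -> : (1 - a) ^+ n = (1 - a) ^+ (n - q.+1) * (1 - a) ^+ q.+1.
  by rewrite -exprD subnK.
rewrite -bin_ffact factS !natrM; move: ('C(_, _)%:R) => B.
set d := (1 - a) ^+ (n - q.+1) => HB.
(* The first bracket is the binomial term, at most 1. The prefactor [a / ((1 - a) * q.+1)] accounts
   for having [q] factors [(1 - a) / a] and [q!] where the binomial bound involves [q.+1]. *)
have -> : a * (d * (1 - a) ^+ q.+1) / ((1 - a) * q.+1%:R) *
    (B * (q.+1%:R * q`!%:R)) =
    (B * a ^+ q.+1 * d) * (((1 - a) / a) ^+ q * q`!%:R).
  rewrite expr_div_n !exprSr; field.
  by rewrite !gt_eqF// ?exprn_gt0// ltr0n.
rewrite ler_piMl// mulr_ge0// exprn_ge0// divr_ge0 ?ltW//.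
Qed.

(** * A common family of guesses for all levels and signs *)

(** A guess consists of a profile, an injection and signs, drawn uniformly and independently. The
    success probabilities multiply, and there are [(2 * K) ^ n] pairs [(l, s)] to serve. *)
Lemma codebook (R : realType) (a : R) (n K q N : nat) :
  0 < a < 1 -> (q < n)%N -> q%:R <= a * n%:R ->
  ((2 * K) ^ n)%:R < expR (a * (1 - a) ^+ n /
    ((1 - a) * q.+1%:R * (n.+1 ^ K)%:R * (2 ^ q.+1)%:R) * N%:R) ->
  exists (t : 'I_N -> {ffun 'I_K -> 'I_n.+1})
    (f : 'I_N -> {ffun 'I_q.+1 -> 'I_n}) (e : 'I_N -> {ffun 'I_q.+1 -> bool}),
  forall (l : {ffun 'I_n -> 'I_K}) (s : {ffun 'I_n -> bool}), exists i,
  [/\ t i = tail l, injective (f i) &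
   forall j : 'I_q.+1, (quantile a (tail l) j <= l (f i j))%N /\ e i j = s (f i j)].
Proof.
move=> a01 qn qan Nbig; have /andP[a0 a1] := a01.
pose F := [set f : {ffun 'I_q.+1 -> 'I_n} | injectiveb f].
pose D := finset.setX (finset.setX [set: {ffun 'I_K -> 'I_n.+1}] F)
  [set: {ffun 'I_q.+1 -> bool}].
pose G (l : {ffun 'I_n -> 'I_K}) := [set f : {ffun 'I_q.+1 -> 'I_n} |
  injectiveb f & [forall j : 'I_q.+1, f j \in [set i | (quantile a (tail l) j <= l i)%N]]].
(* The injection is the only freedom left: the profile and the signs along it are forced by [x]. *)
pose good (x : {ffun 'I_n -> 'I_K} * {ffun 'I_n -> bool}) :=
  [set (tail x.1, f : {ffun 'I_q.+1 -> 'I_n}, [ffun j => x.2 (f j)]) | f in G x.1].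
have cardD : #|D| = (n.+1 ^ K * n ^_ q.+1 * 2 ^ q.+1)%N.
  by rewrite !cardsX !cardsT card_inj_ffuns !card_ffun !card_ord card_bool.
have D0 : (0 < #|D|)%N.
  by rewrite cardD 2!muln_gt0 !expn_gt0 ffact_gt0 qn.
have goodD x : good x \subset D.
  apply/fintype.subsetP => _ /imsetP[f fG ->].
  by rewrite inE in fG; have /andP[fI _] := fG; rewrite !inE/= fI.
have goodp x : a * (1 - a) ^+ n /
    ((1 - a) * q.+1%:R * (n.+1 ^ K)%:R * (2 ^ q.+1)%:R) * #|D|%:R <= #|good x|%:R.
  rewrite card_imset; last by move=> f g [].
  rewrite cardD 2!natrM.
  apply: (@le_trans _ _ (\prod_(j < q.+1)
      (#|[set i | (quantile a (tail x.1) j <= x.1 i)%N]| - j))%:R); last first.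
    by rewrite ler_nat; exact: (prod_le_card_inj _ 
      (fun j => [set i | (quantile a (tail x.1) j <= x.1 i)%N])).
  apply: le_trans (prod_card_quantile_ffact x.1 a01 qn qan).
  have T0 : (n.+1 ^ K)%:R != 0 :> R by rewrite pnatr_eq0 expn_eq0.
  have S0 : (2 ^ q.+1)%:R != 0 :> R by rewrite pnatr_eq0 expn_eq0.
  have Q0 : q.+1%:R != 0 :> R by rewrite pnatr_eq0.
  move: (n.+1 ^ K)%:R (2 ^ q.+1)%:R q.+1%:R T0 S0 Q0 => T S Q T0 S0 Q0.
  rewrite le_eqVlt; apply/orP; left; apply/eqP; field.
  by rewrite T0 S0 Q0 gt_eqF// subr_gt0.
have [|c cgood] := random_cover D0 goodD goodp (N := N).
  apply: le_lt_trans Nbig.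
  by rewrite card_prod !card_ffun !card_ord card_bool -expnMn mulnC.
exists (fun i => (c i).1.1), (fun i => (c i).1.2), (fun i => (c i).2) => l s.
have [i /imsetP[f fG ci]] := cgood (l, s); exists i; rewrite ci/=.
rewrite inE in fG; have /andP[/injectiveP fI /forallP fl] := fG.
by split=> // j; rewrite ffunE; have := fl j; rewrite inE.
Qed.

(** * From guesses to homothets covering the cross-polytope *)

(** Each coordinate is hit by at most one slot and moves towards 0 without overshooting, so its
    absolute value drops by exactly that weight. *)
Lemma norm1_sub_signed (R : realType) (n m : nat) (x : 'rV[R]_n)
    (f : 'I_m -> 'I_n) (e : 'I_m -> bool) (w : 'I_m -> R) :
  injective f ->
  (forall j, e j = (x ord0 (f j) < 0)) -> (forall j, 0 <= w j <= `|x ord0 (f j)|) ->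
  norm1 (x - \row_i \sum_(j | f j == i) (-1) ^+ e j * w j) =
  norm1 x - \sum_j w j.
Proof.
move=> fI ex wx; rewrite /norm1.
have -> : \sum_j w j = \sum_i \sum_(j | f j == i) w j.
  rewrite (exchange_big_dep xpredT)//=; apply: eq_bigr => j _.
  by rewrite (big_pred1 (f j)).
rewrite -sumrB; apply: eq_bigr => i _; rewrite !mxE.
have [j /eqP fji|fi] := pickP [pred j | f j == i]; last first.
  by rewrite !big_pred0// !subr0.
have fE : [pred j | f j == i] =1 pred1 j.
  by move=> k /=; rewrite -fji (inj_eq fI).
rewrite !(big_pred1 j)// -fji ex; have /andP[w0 wxj] := wx j.
have [x0|x0] := ltP (x ord0 (f j)) 0.
  rewrite ltr0_norm// in wxj *; rewrite expr1 mulN1r opprK.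
  by rewrite ler0_norm; lra.
rewrite ger0_norm// in wxj *; rewrite expr0 mul1r.
by rewrite ger0_norm; lra.
Qed.

Lemma cross_polytope_homothet (R : realType) (n : nat) (x c : 'rV[R]_n) (g : R) :
  0 < g -> norm1 (x - c) <= g -> homothet c g (@cross_polytope R n) x.
Proof.
move=> g0 xcg; exists (g^-1 *: (x - c)); last first.
  by rewrite scalerA divff ?gt_eqF// scale1r addrC subrK.
rewrite /cross_polytope/= /norm1; under eq_bigr do rewrite mxE normrM.
by rewrite -mulr_sumr gtr0_norm ?invr_gt0// mulrC ler_pdivrMr// mul1r.
Qed.

Lemma grid_floor_le (R : realType) (h z : R) : 0 < h -> 0 <= z ->
  (h * (Num.truncn (Num.sqrt z / h))%:R) ^+ 2 <= z.
Proof.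
move=> h0 z0; rewrite -[leRHS]sqr_sqrtr// lerXn2r ?nnegrE ?sqrtr_ge0//.
  by rewrite mulr_ge0// ltW.
by rewrite mulrC -ler_pdivlMr// truncn_le divr_ge0 ?sqrtr_ge0// ltW.
Qed.

(** With [t] the rounded level, [z <= (h t + h) ^ 2]; expand and use
    [2 h t <= 1 + (h t) ^ 2 <= 1 + z] and [h ^ 2 <= h]. Summed over [n] coordinates of total mass at
    most [n], the error is at most [3 h n], which explains the [3 * h] below. *)
Lemma grid_floor_ge (R : realType) (h z : R) : 0 < h <= 1 -> 0 <= z ->
  z <= (h * (Num.truncn (Num.sqrt z / h))%:R) ^+ 2 + h * (2 + z).
Proof.
move=> /andP[h0 h1] z0; have := grid_floor_le h0 z0.
have : Num.sqrt z < h * (Num.truncn (Num.sqrt z / h)).+1%:R.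
  by rewrite mulrC -ltr_pdivrMr// truncnS_gt.
set t : R := (Num.truncn _)%:R; rewrite -natr1 => zt tz.
have t0 : 0 <= t by rewrite ler0n.
have : z <= (h * (t + 1)) ^+ 2.
  by rewrite -[leLHS]sqr_sqrtr// lerXn2r ?nnegrE ?sqrtr_ge0 ?mulr_ge0 ?addr_ge0// ltW.
have : 2 * (h * t) <= 1 + (h * t) ^+ 2 by have := sqr_ge0 (h * t - 1); nra.
nra.
Qed.

Lemma Gamma_cross_polytope_le (R : realType) (a h g : R) (n N : nat) :
  0 < a < 1 -> 0 < h <= 1 -> (0 < n)%N -> 1 - a + 3 * h <= g ->
  let K := (Num.truncn (Num.sqrt n%:R / h)).+1 in
  let q := Num.truncn (a * n%:R) in
  ((2 * K) ^ n)%:R < expR (a * (1 - a) ^+ n /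
    ((1 - a) * q.+1%:R * (n.+1 ^ K)%:R * (2 ^ q.+1)%:R) * N%:R) ->
  (Gamma N (@cross_polytope R n) <= g%:E)%E.
Proof.
move=> a01 h01 n0 ag K q Nbig; have /andP[a0 a1] := a01; have /andP[h0 h1] := h01.
have nR0 : 0 < n%:R :> R by rewrite ltr0n.
have an0 : 0 <= a * n%:R by rewrite mulr_ge0 ?ltW.
have qan : q%:R <= a * n%:R by rewrite truncn_le.
have qn : (q < n)%N by rewrite -(ltr_nat R) (le_lt_trans qan)// gtr_pMl.
have [t [f [e cover]]] := codebook a01 qn qan Nbig.
have g0 : 0 < g by lra.
(* Level [u] stands for [(h u) ^ 2] on the scale where the norm is at most [n]; dividing by [n]
   returns to the original scale. *)
pose F u : R := (h * u%:R) ^+ 2.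
pose w i (j : 'I_q.+1) : R := F (quantile a (t i) j) / n%:R.
pose c i : 'rV[R]_n := \row_k \sum_(j | f i j == k) (-1) ^+ e i j * w i j.
apply: ereal_inf_lbound; exists g => //; split => //; exists c => x x1.
have xi k : `|x ord0 k| <= 1.
  apply: le_trans x1; rewrite /norm1 (bigD1 k)//= lerDl sumr_ge0//.
have lt_level k : (Num.truncn (Num.sqrt (n%:R * `|x ord0 k|) / h) < K)%N.
  rewrite ltnS le_truncn// ler_pM2r ?invr_gt0// ler_wsqrtr// ger_pMr//.
pose l : {ffun 'I_n -> 'I_K} := [ffun k => Ordinal (lt_level k)].
pose s : {ffun 'I_n -> bool} := [ffun k => x ord0 k < 0].
have [i [ti fI lf]] := cover l s.
exists i => //; apply: cross_polytope_homothet => //.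
have F_nd : {homo F : u v / (u <= v)%N >-> u <= v}.
  move=> u v uv; rewrite /F lerXn2r ?nnegrE ?mulr_ge0 ?(ltW h0)//.
  by rewrite ler_pM2l// ler_nat.
have Fl k : F (l k) <= n%:R * `|x ord0 k|.
  by rewrite ffunE; apply: grid_floor_le => //; rewrite mulr_ge0 ?ltW.
rewrite norm1_sub_signed//; last 2 first.
- by move=> j; have [_ ->] := lf j; rewrite ffunE.
- move=> j; apply/andP; split; first by rewrite divr_ge0 ?sqr_ge0.
  rewrite ler_pdivrMr// mulrC.
  by apply: le_trans (Fl _); rewrite ti F_nd//; have [] := lf j.
have lo : n%:R * norm1 x <= \sum_k F (l k) + h * (2 * n%:R + n%:R * norm1 x).
  have -> : 2 * n%:R + n%:R * norm1 x = \sum_k (2 + n%:R * `|x ord0 k|).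
    by rewrite big_split/= -mulr_sumr sumr_const card_ord mulr_natr.
  rewrite /norm1 !mulr_sumr -big_split/=; apply: ler_sum => k _.
  by rewrite ffunE; apply: grid_floor_ge => //; rewrite mulr_ge0 ?ltW.
have sumw : n%:R * \sum_j w i j >= a * \sum_k F (l k).
  have -> : n%:R * \sum_j w i j = \sum_(j < q.+1) F (quantile a (tail l) j).
    rewrite mulr_sumr; apply: eq_bigr => j _.
    by rewrite /w ti mulrC divfK// gt_eqF.
  (* Capturing the mass needs at least [a n] slots, whereas counting injections needs [q <= a n]:
     hence [q.+1] slots with [q] the floor of [a n]. *)
  apply: quantile_sum => //; [by rewrite /F mulr0 expr0n|exact: ltW|].
  by apply/ltW; exact: truncnS_gt.
have x1' : norm1 x <= 1 by exact: x1.
rewrite -(ler_pM2l nR0) mulrBr.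
have : h * (n%:R * norm1 x) <= h * n%:R by rewrite ler_pM2l// ger_pMr.
have : (1 - a) * (n%:R * norm1 x) <= (1 - a) * n%:R.
  by rewrite ler_pM2l ?subr_gt0// ger_pMr.
have : n%:R * (1 - a + 3 * h) <= n%:R * g by rewrite ler_pM2l.
have : a * (n%:R * norm1 x) <= a * (\sum_k F (l k) + h * (2 * n%:R + n%:R * norm1 x)).
  by rewrite ler_pM2l.
have : a * (h * (2 * n%:R + n%:R * norm1 x)) <= h * (2 * n%:R + n%:R * norm1 x).
  by rewrite ler_piMl ?(ltW a1)// mulr_ge0 ?(ltW h0)// addr_ge0// mulr_ge0// sumr_ge0.
move: sumw; set X := norm1 x; set W := \sum_j w i j; set L := \sum_k F (l k).
by move=> *; lra.
Qed.

(** * Asymptotics: [2 ^ n] centers suffice *)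

(** [K] is of order [sqrt n] and [ln n.+1] is at most 4 times the fourth root of [n], so the left
    side is the exponential of a quantity of order [n ^ (3/4)]. *)
Lemma subexponential (R : realType) (lam h B : R) : 0 < lam -> 0 < h -> 0 < B ->
  \forall n \near \oo%classic,
    let K := (Num.truncn (Num.sqrt n%:R / h)).+1 in
    B * n%:R ^+ 2 * K%:R * n.+1%:R ^+ K < expR (lam * n%:R).
Proof.
move=> lam0 h0 B0.
(* Chosen so that [lam * M] is the constant of the final exponent; [M <= r] then suffices, since
   [r * r * s = n]. *)
pose M := 4 * (h^-1 + 5) / lam.
near=> n; pose K := (Num.truncn (Num.sqrt n%:R / h)).+1; rewrite -/K.
have hV0 : 0 < h^-1 by rewrite invr_gt0.
have n1 : 1 <= n%:R :> R by near: n; exact: nbhs_infty_ger.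
have n0 : 0 <= n%:R :> R by exact: ler0n.
set s : R := Num.sqrt n%:R; set r := Num.sqrt s.
have s0 : 0 <= s by exact: sqrtr_ge0.
have r0 : 0 <= r by exact: sqrtr_ge0.
have ns : n%:R = s ^+ 2 :> R by rewrite sqr_sqrtr.
have sr : s = r ^+ 2 by rewrite sqr_sqrtr.
have r1 : 1 <= r.
  rewrite -(ler_pXn2r (n := 2)) ?nnegrE// -sr expr1n.
  by rewrite -(ler_pXn2r (n := 2)) ?nnegrE// -ns expr1n.
have s1 : 1 <= s by rewrite sr exprn_ege1.
have M0 : 0 <= M by rewrite divr_ge0 ?mulr_ge0 ?addr_ge0 ?ltW.
have Mr : M <= r.
  rewrite -(ler_pXn2r (n := 2)) ?nnegrE// -sr -(ler_pXn2r (n := 2)) ?nnegrE ?exprn_ge0//.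
  by rewrite -ns; near: n; exact: nbhs_infty_ger.
have Ks : K%:R <= s / h + 1.
  by rewrite /K -natr1 lerD2r truncn_le divr_ge0// ltW.
have Kn : K%:R <= (h^-1 + 1) * n%:R.
  have sn : s <= n%:R by rewrite ns expr2 ler_pMr; lra.
  have : s * h^-1 <= n%:R * h^-1 by rewrite ler_pM2r.
  by rewrite mulrDl mul1r [h^-1 * _]mulrC; lra.
have Bn : B * (h^-1 + 1) <= n%:R by near: n; exact: nbhs_infty_ger.
have lnn : ln n.+1%:R <= 4 * r.
  apply: (@le_trans _ _ (ln ((1 + r) ^+ 4))).
    rewrite ler_ln ?posrE ?exprn_gt0 ?ltr0n//; last lra.
    by rewrite -natr1 ns sr; have : 0 <= r ^+ 3; [exact: exprn_ge0|nra].
  rewrite lnXn; last lra.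
  by rewrite -[_ *+ 4]mulr_natl ler_pM2l// le_ln1Dx//; lra.
(* For large [n] the factor [B n ^ 2 K] is at most [n ^ 4], absorbed by four more powers of
   [n.+1]. *)
apply: (@lt_le_trans _ _ (n.+1%:R ^+ (K + 4))).
  rewrite addnC exprD ltr_pM2r ?exprn_gt0 ?ltr0n//.
  apply: (@le_lt_trans _ _ (n%:R ^+ 4)); last first.
    by rewrite ltrXn2r// ?nnegrE// ltr_nat.
  have -> : n%:R ^+ 4 = n%:R * n%:R ^+ 2 * n%:R :> R by ring.
  apply: (@le_trans _ _ (B * n%:R ^+ 2 * ((h^-1 + 1) * n%:R))).
    by rewrite ler_wpM2l// mulr_ge0 ?exprn_ge0// ltW.
  have -> : B * n%:R ^+ 2 * ((h^-1 + 1) * n%:R) =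
      (B * (h^-1 + 1)) * n%:R ^+ 2 * n%:R by ring.
  by rewrite ler_wpM2r// ler_wpM2r// exprn_ge0.
rewrite -[leLHS]lnK ?posrE ?exprn_gt0 ?ltr0n// ler_expR lnXn ?ltr0n//.
rewrite -[_ *+ (K + 4)]mulr_natl natrD.
have lnn0 : 0 <= ln n.+1%:R :> R by rewrite ln_ge0// ler1n.
apply: (@le_trans _ _ ((s * (h^-1 + 5)) * (4 * r))).
  apply: ler_pM => //.
  by rewrite mulrDr; lra.
have -> : s * (h^-1 + 5) * (4 * r) = lam * (M * r * s).
  by rewrite /M; field; rewrite !gt_eqF.
rewrite ler_pM2l// ns expr2 ler_wpM2r// [in leRHS]sr expr2 ler_wpM2r//.
Unshelve. all: by end_near.
Qed.

(** With [b = 1 - a] and [q <= a n], the quotient of [b ^ n 2 ^ n] by [2 ^ q] is at least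
    [(b 2 ^ b) ^ n = expR (lam n)], which beats the remaining subexponential factors. *)
Lemma enough_centers (R : realType) (a h : R) :
  0 < a < 1 -> 0 < h -> 0 < ln (1 - a) + (1 - a) * ln 2 ->
  \forall n \near \oo%classic,
    let K := (Num.truncn (Num.sqrt n%:R / h)).+1 in
    let q := Num.truncn (a * n%:R) in
    ((2 * K) ^ n)%:R < expR (a * (1 - a) ^+ n /
      ((1 - a) * q.+1%:R * (n.+1 ^ K)%:R * (2 ^ q.+1)%:R) * (2 ^ n)%:R).
Proof.
move=> /andP[a0 a1] h0 lam0; set lam : R := ln _ + _ in lam0.
(* The 4 gathers the 2 of [2 * K] and the extra 2 of [2 ^ q.+1]; the [a] in the denominator cancels
   the one in the exponent. *)
have B0 : 0 < 4 / a by rewrite divr_gt0.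
near=> n.
pose K := (Num.truncn (Num.sqrt n%:R / h)).+1; pose q := Num.truncn (a * n%:R).
rewrite -/K -/q.
have b0 : 0 < 1 - a by rewrite subr_gt0.
have n0 : (0 < n)%N by near: n; exact: nbhs_infty_gt.
have nR0 : 0 < n%:R :> R by rewrite ltr0n.
have big : 4 / a * n%:R ^+ 2 * K%:R * n.+1%:R ^+ K < expR (lam * n%:R).
  by rewrite /K; near: n; exact: subexponential.
have qan : q%:R <= a * n%:R by rewrite truncn_le mulr_ge0// ltW.
have qn : (q < n)%N by rewrite -(ltr_nat R) (le_lt_trans qan)// gtr_pMl.
have l2 : 0 < ln 2 :> R by rewrite ln_gt0// ltr1n.
have exp2 m : 2 ^+ m = expR (ln 2 * m%:R) :> R.
  by rewrite expRM_natr lnK// posrE.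
have lamE : expR (lam * n%:R) * 2 ^+ q <= (1 - a) ^+ n * 2 ^+ n.
  rewrite !exp2 -[1 - a]lnK ?posrE// -expRM_natr -!expRD ler_expR /lam.
  have : ln 2 * q%:R <= ln 2 * (a * n%:R) :> R by rewrite ler_pM2l.
  by move=> ?; lra.
(* The crude bound [2 K <= expR (2 K)] is enough here. *)
apply: (@le_lt_trans _ _ (expR ((2 * K)%:R * n%:R))).
  rewrite expRM_natr natrX lerXn2r ?nnegrE ?expR_ge0//.
  by apply: le_trans (expR_ge1Dx _); rewrite lerDr.
rewrite ltr_expR !natrX mulrAC ltr_pdivlMr; last first.
  by rewrite !mulr_gt0 ?exprn_gt0// ltr0n.
apply: (@le_lt_trans _ _ (a * (4 / a * n%:R ^+ 2 * K%:R * n.+1%:R ^+ K) * 2 ^+ q)).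
  rewrite exprS; set T := n.+1%:R ^+ K; set S := 2 ^+ q.
  have -> : a * (4 / a * n%:R ^+ 2 * K%:R * T) * S =
    (2 * K)%:R * n%:R * (1 * n%:R * T * (2 * S)).
    by rewrite natrM; field; rewrite gt_eqF.
  rewrite ler_wpM2l ?mulr_ge0// ler_wpM2r ?mulr_ge0 ?exprn_ge0//.
  rewrite ler_wpM2r ?exprn_ge0// ler_pM ?(ltW b0) ?ler_nat//.
  by rewrite lerBlDr lerDl ltW.
rewrite -mulrA -[ltRHS]mulrA ltr_pM2l//.
by apply: lt_le_trans lamE; rewrite ltr_pM2r ?exprn_gt0.
Unshelve. all: by end_near.
Qed.

(** * The threshold and the limit superior *)

(** The defining equation says that [ln b + b * ln 2] vanishes at [gamma_sgn], and this expression
    is strictly increasing. *)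
Lemma gamma_sgn_lt (R : realType) (b : R) :
  gamma_sgn R < b -> 0 < ln b + b * ln 2.
Proof.
have [/andP[g2 _] gE] := gamma_sgnP R => gb.
have g0 : 0 < gamma_sgn R by apply: lt_trans g2; rewrite invr_gt0.
have l2 : 0 < ln 2 :> R by rewrite ln_gt0// ltr1n.
have : ln (gamma_sgn R) < ln b by rewrite ltr_ln ?posrE// (lt_trans g0).
by nra.
Qed.

Lemma limn_esup_le_near (R : realType) (u : nat -> \bar R) (l : \bar R) :
  (\forall n \near \oo%classic, (u n <= l)%E) -> (limn_esup u <= l)%E.
Proof.
move=> ul; apply: (@le_trans _ _ (ereal_sup [set u n | n in [set n | (u n <= l)%E]])%classic).
  by apply: ereal_inf_lbound; exists [set n | (u n <= l)%E]%classic.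
by apply: ge_ereal_sup => _ [n /= un <-].
Qed.

Lemma Gamma_cross_polytope_near (R : realType) (g : R) : gamma_sgn R < g ->
  \forall n \near \oo%classic, (Gamma (2 ^ n)%N (@cross_polytope R n) <= g%:E)%E.
Proof.
move=> gg; have [/andP[g2 g1] _] := gamma_sgnP R.
(* The cap at 1 keeps [a = 1 - b] positive even when [g >= 1]. *)
pose b := (gamma_sgn R + Num.min g 1) / 2.
have [bg bg' b1] : [/\ gamma_sgn R < b, b < g & b < 1].
  have : gamma_sgn R < Num.min g 1 by rewrite lt_min gg.
  have : Num.min g 1 <= g by rewrite ge_min lexx.
  have : Num.min g 1 <= 1 by rewrite ge_min lexx orbT.
  by move=> *; split; rewrite /b; lra.
have a01 : 0 < 1 - b < 1 by apply/andP; split; lra.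
(* The gap [g - b] pays for the rounding error [3 * h]. *)
pose h := Num.min ((g - b) / 3) 1.
have [h01 hg] : 0 < h <= 1 /\ 3 * h <= g - b.
  have hg : h <= (g - b) / 3 by rewrite ge_min lexx.
  have h1 : h <= 1 by rewrite ge_min lexx orbT.
  have h0 : 0 < h by rewrite lt_min ltr01 andbT; lra.
  by split; [rewrite h0|lra].
have h0 : 0 < h by case/andP: h01.
have lam0 : 0 < ln (1 - (1 - b)) + (1 - (1 - b)) * ln 2.
  by rewrite subKr gamma_sgn_lt.
near=> n; apply: (Gamma_cross_polytope_le a01 h01).
- by near: n; exact: nbhs_infty_gt.
- lra.
- by near: n; exact: enough_centers.
Unshelve. all: by end_near.
Qed.

Local Open Scope classical_set_scope.

Theorem theorem1p3 (R : realType) :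
  (forall g : R, gamma_sgn R < g ->
     \forall n \near \oo%classic, (2 <= n)%N ->
       (Gamma (2 ^ n)%N (@cross_polytope R n) <= g%:E)%E) /\
  (limn_esup (fun n : nat => Gamma (2 ^ n)%N (@cross_polytope R n))
     <= (gamma_sgn R)%:E)%E.
Proof.
split=> [g gg|].
  by apply: filterS (Gamma_cross_polytope_near gg) => n + _.
apply/lee_addgt0Pr => e e0; apply: limn_esup_le_near.
by apply: Gamma_cross_polytope_near; rewrite ltrDl.
Qed.
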